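(* Let $\mathcal{A},\mathcal{C},\mathcal{Z}\in\mathbb{R}^{n\times n}$ be lattice bases with $\mathbb{L}(\mathcal{Z})\subset\mathbb{L}(\mathcal{C})\subset\mathbb{L}(\mathcal{A})$, and write $T_{\mathcal{A}}=\mathbb{L}(\mathcal{A})/\mathbb{L}(\mathcal{Z})$, $T_{\mathcal{C}}=\mathbb{L}(\mathcal{C})/\mathbb{L}(\mathcal{Z})$. Let $\mathbb{L}^{\mathfrak{d}}(\mathcal{A})$, $\mathbb{L}^{\mathfrak{c}}(\mathcal{A})$ be crystals and let $$L:\mathcal{L}(T_{\mathcal{A}}^{\mathfrak{d}})\to\mathcal{L}(T_{\mathcal{A}}^{\mathfrak{c}}),\quad (Lf)(x)=\sum_{y\in T_{\mathcal{A}}}m_L^{(y)}f(x+y),\quad m_L^{(y)}\in\mathbb{C}^{|\mathfrak{c}|\times|\mathfrak{d}|},$$ be a multiplication operator. Let $\mathfrak{t}_1,\ldots,\mathfrak{t}_p\in\mathbb{L}(\mathcal{A})$ be a complete list of distinct representatives of $T_{\mathcal{A},\mathcal{C}}=\mathbb{L}(\mathcal{A})/\mathbb{L}(\mathcal{C})$, and for $\mathfrak{s}\in\{\mathfrak{d},\mathfrak{c}\}$ let $\hat{\mathfrak{s}}=(\mathfrak{t}_1+\mathfrak{s},\ldots,\mathfrak{t}_p+\mathfrak{s})$ be the corresponding structure element of length $p|\mathfrak{s}|$. Then the multiplication operator $$G:\mathcal{L}(T_{\mathcal{C}}^{\hat{\mathfrak{d}}})\to\mathcal{L}(T_{\mathcal{C}}^{\hat{\mathfrak{c}}}),\quad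 (Gg)(x)=\sum_{y\in T_{\mathcal{C}}}m_G^{(y)}g(x+y),\quad m_G^{(y)}\in\mathbb{C}^{p|\mathfrak{c}|\times p|\mathfrak{d}|},$$ whose multipliers are the $p\times p$ block matrices with blocks $$(m_G^{(y)})_{i,k}:=m_L^{(y-\mathfrak{t}_i+\mathfrak{t}_k)}\in\mathbb{C}^{|\mathfrak{c}|\times|\mathfrak{d}|},\qquad i,k=1,\ldots,p,$$ satisfies $$\eta^{\mathfrak{c}}\circ L=G\circ\eta^{\mathfrak{d}},$$ where for $\mathfrak{s}\in\{\mathfrak{d},\mathfrak{c}\}$ the map $\eta^{\mathfrak{s}}:\mathcal{L}(T_{\mathcal{A}}^{\mathfrak{s}})\to\mathcal{L}(T_{\mathcal{C}}^{\hat{\mathfrak{s}}})$, $f(\cdot)\mapsto(f(\cdot+\mathfrak{t}_1),\ldots,f(\cdot+\mathfrak{t}_p))$, is the natural isomorphism between the congruent crystal representations.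
   Context: A lattice basis is an invertible matrix $\mathcal{A}\in\mathbb{R}^{n\times n}$; its lattice is $\mathbb{L}(\mathcal{A})=\mathcal{A}\mathbb{Z}^n$. A structure element $\mathfrak{s}=(\mathfrak{s}_1,\ldots,\mathfrak{s}_m)$ is a tuple of points of a primitive cell of the lattice (a volume of $\mathbb{R}^n$ whose lattice translates tile $\mathbb{R}^n$ without overlap), $|\mathfrak{s}|=m$, and for $x\in\mathbb{R}^n$, $x+\mathfrak{s}=(x+\mathfrak{s}_1,\ldots,x+\mathfrak{s}_m)$. The crystal is $\mathbb{L}^{\mathfrak{s}}(\mathcal{A})=\{x+\mathfrak{s}:x\in\mathbb{L}(\mathcal{A})\}$. All operators live on finite tori: $\mathcal{Z}$ defines an arbitrary fixed sublattice, $T_{\mathcal{A}}=\mathbb{L}(\mathcal{A})/\mathbb{L}(\mathcal{Z})$, and $\mathcal{L}(T_{\mathcal{A}}^{\mathfrak{s}})=\{f:T_{\mathcal{A}}\to\mathbb{C}^{|\mathfrak{s}|}\}$, where $f_j(x)$ is the value attached to position $x+\mathfrak{s}_j$. Arguments and superscripts such as $y-\mathfrak{t}_i+\mathfrak{t}_k$ are read in $T_{\mathcal{A}}$, i.e. modulo $\mathbb{L}(\mathcal{Z})$. A multiplication operator is a linear operator of the form $(Lf)(x)=\sum_y m_L^{(y)}f(x+y)$ with fixed matrices $m_L^{(y)}$. *)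

(* Defs.v *)
From HB Require Import structures.
From mathcomp Require Import all_boot all_order all_algebra.
From mathcomp Require Import all_classical all_reals.
From mathcomp Require Import complex.

Set Implicit Arguments.
Unset Strict Implicit.
Unset Printing Implicit Defensive.

Import Order.TTheory GRing.Theory Num.Theory.

Local Open Scope ring_scope.
Local Open Scope quotient_scope.

Definition lattice_set (R : realType) (n : nat) (A : 'M[R]_n) :
    {pred 'cV[R]_n} :=
  fun x => `[< exists v : 'cV[int]_n, x = A *m map_mx intr v >].

Lemma lattice_set_zmod_closed (R : realType) (n : nat) (A : 'M[R]_n) :
  zmod_closed (lattice_set A).
Proof.
split; first by apply/asboolP; exists 0; rewrite map_mx0 mulmx0.
move=> _ _ /asboolP[u ->] /asboolP[v ->]; apply/asboolP.
by exists (u - v); rewrite map_mxB mulmxBr.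
Qed.

HB.instance Definition _ (R : realType) (n : nat) (A : 'M[R]_n) :=
  GRing.isZmodClosed.Build 'cV[R]_n (lattice_set A)
    (lattice_set_zmod_closed A).

Record lattice (R : realType) (n : nat) (A : 'M[R]_n) := Lattice {
  lattice_val :> 'cV[R]_n;
  latticeP : lattice_val \in lattice_set A }.

HB.instance Definition _ (R : realType) (n : nat) (A : 'M[R]_n) :=
  [isSub for @lattice_val R n A].
HB.instance Definition _ (R : realType) (n : nat) (A : 'M[R]_n) :=
  [Choice of lattice A by <:].
HB.instance Definition _ (R : realType) (n : nat) (A : 'M[R]_n) :=
  [SubChoice_isSubZmodule of lattice A by <:].

Definition sublattice (R : realType) (n : nat) (A Z : 'M[R]_n) :
    {pred lattice A} :=
  fun x => lattice_val x \in lattice_set Z.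
Arguments sublattice {R n} A Z.

Lemma sublattice_zmod_closed (R : realType) (n : nat) (A Z : 'M[R]_n) :
  zmod_closed (sublattice A Z).
Proof.
by split=> [|x y xZ yZ]; [exact: rpred0 | exact: rpredB].
Qed.

HB.instance Definition _ (R : realType) (n : nat) (A Z : 'M[R]_n) :=
  GRing.isZmodClosed.Build (lattice A) (sublattice A Z)
    (sublattice_zmod_closed A Z).

(* The quotient L(A)/L(Z).  The inclusion of L(Z) in L(A) is not part of the
   definition; without it this is L(A) modulo its intersection with L(Z). *)
Definition torus (R : realType) (n : nat) (A Z : 'M[R]_n) : Type :=
  Quotient.quot (sublattice A Z).
Arguments torus {R n} A Z.

HB.instance Definition _ (R : realType) (n : nat) (A Z : 'M[R]_n) :=
  GRing.Zmodule.on (torus A Z).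

Definition tcoset (R : realType) (n : nat) (A Z : 'M[R]_n) (x : lattice A) :
    torus A Z :=
  \pi_(Quotient.quot (sublattice A Z)) x.
Arguments tcoset {R n} A Z x.

Lemma coset_eqP (R : realType) (n : nat) (A Z : 'M[R]_n) (x y : lattice A) :
  tcoset A Z x = tcoset A Z y <->
  lattice_val x - lattice_val y \in lattice_set Z.
Proof.
have -> : (lattice_val x - lattice_val y \in lattice_set Z) =
          (x - y \in sublattice A Z) by [].
by rewrite Quotient.idealrBE; split=> [h|/eqP//]; apply/eqP.
Qed.

Lemma coset_surj (R : realType) (n : nat) (A Z : 'M[R]_n) (X : torus A Z) :
  exists x, X = tcoset A Z x.
Proof. by exists (repr X); rewrite /tcoset reprK. Qed.

Section Inclusion.
Context (R : realType) (n : nat) (A C Z : 'M[R]_n).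
Hypothesis CA : {subset lattice_set C <= lattice_set A}.

Definition lattice_incl (x : lattice C) : lattice A :=
  Lattice (CA (latticeP x)).

(* The map L(C)/L(Z) -> L(A)/L(Z) induced by the inclusion; by
   torus_incl_coset it does not depend on the representatives. *)
Definition torus_incl (X : torus C Z) : torus A Z :=
  tcoset A Z (lattice_incl (repr X)).

Lemma torus_incl_coset (x : lattice C) :
  torus_incl (tcoset C Z x) = tcoset A Z (lattice_incl x).
Proof.
apply/coset_eqP/(coset_eqP Z (repr (tcoset C Z x)) x).
exact: (reprK (tcoset C Z x)).
Qed.

Lemma torus_inclD : {morph torus_incl : X Y / X + Y}.
Proof.
move=> X Y; have [[x ->] [y ->]] := (coset_surj X, coset_surj Y).
have cD (B : 'M[R]_n) (u v : lattice B) :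
    tcoset B Z u + tcoset B Z v = tcoset B Z (u + v) by rewrite /tcoset raddfD.
rewrite cD !torus_incl_coset cD; congr (tcoset A Z _).
exact/val_inj.
Qed.

Lemma torus_incl_inj : injective torus_incl.
Proof.
move=> X Y; have [[x ->] [y ->]] := (coset_surj X, coset_surj Y).
by rewrite !torus_incl_coset => /coset_eqP h; apply/coset_eqP.
Qed.

End Inclusion.

(* Guarantees that the finitely supported sums over a torus below are genuine
   sums over all its points. *)
Lemma torus_finite (R : realType) (n : nat) (A Z : 'M[R]_n) :
  Z \in unitmx -> {subset lattice_set Z <= lattice_set A} ->
  finite_set [set: torus A Z].
Proof.
move=> Zu ZA.
have /choice[v vP] (j : 'I_n) :
    exists v : 'cV[int]_n, col j Z = A *m map_mx intr v.
  apply/asboolP; apply: ZA; apply/asboolP; exists (delta_mx j 0).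
  by rewrite map_delta_mx colE.
pose M := \matrix_(i, j) v j i 0.
have ZM : Z = A *m map_mx intr M.
  apply/matrixP => i j; have /matrixP/(_ i 0) := vP j.
  by rewrite !mxE => ->; apply: eq_bigr => k _; rewrite !mxE.
have d0 : \det M != 0.
  move: Zu; rewrite ZM unitmx_mul => /andP[_].
  by rewrite unitmxE det_map_mx unitfE intr_eq0.
pose N := `|\det M|%N.
have AP (w : 'cV[int]_n) : A *m map_mx intr w \in lattice_set A.
  by apply/asboolP; exists w.
pose g (w : {ffun 'I_n -> 'I_N.+1}) : torus A Z :=
  tcoset A Z (Lattice (AP (\col_i (w i)%:Z))).
apply: (@sub_finite_set _ _ [set g w | w in setT]); last first.
  exact/finite_image/finite_finset.
move=> X _; have [x ->] := coset_surj X.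
have /asboolP[w xw] := latticeP x.
have rP i : (`|(w i ord0 %% \det M)%Z| < N.+1)%N.
  rewrite ltnS -lez_nat gez0_abs ?modz_ge0// abszE.
  by rewrite ltW// ltz_mod.
exists [ffun i => Ordinal (rP i)] => //; apply/coset_eqP => /=.
rewrite xw -mulmxBr -map_mxB; apply/asboolP.
exists (\adj M *m \col_i (- (w i ord0 %/ \det M)%Z)).
rewrite ZM -mulmxA -map_mxM mulmxA mul_mx_adj mul_scalar_mx.
congr (_ *m map_mx _ _); apply/colP => i; rewrite !mxE ffunE /=.
rewrite gez0_abs ?modz_ge0// mulrN mulrC.
rewrite [in X in _ - X](divz_eq (w i ord0) (\det M)).
by rewrite opprD addrCA subrr addr0.
Qed.

(* The translates of P by the lattice tile the space exactly: every point lies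
   in one and only one of them. *)
Definition primitive_cell (R : realType) (n : nat) (A : 'M[R]_n)
    (P : set 'cV[R]_n) : Prop :=
  forall y, exists! x, x \in lattice_set A /\ P (y - x).

Definition structure_element (R : realType) (n : nat) (A : 'M[R]_n) (m : nat)
    (s : 'I_m -> 'cV[R]_n) : Prop :=
  exists2 P : set 'cV[R]_n, primitive_cell A P & forall j, P (s j).

(* Only the length m of s enters the type; the entry j of f x is the value
   attached to the position x + s j. *)
Definition crystal_fun (R : realType) (n : nat) (A Z : 'M[R]_n) (m : nat)
    (s : 'I_m -> 'cV[R]_n) : Type :=
  torus A Z -> 'cV[R[i]]_m.
Arguments crystal_fun {R n} A Z {m} s.

HB.instance Definition _ (R : realType) (n : nat) (A Z : 'M[R]_n) (m : nat)
    (s : 'I_m -> 'cV[R]_n) :=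
  GRing.Lmodule.on (crystal_fun A Z s).

Definition mult_op (R : realType) (n : nat) (A Z : 'M[R]_n) (md mc : nat)
    (d : 'I_md -> 'cV[R]_n) (c : 'I_mc -> 'cV[R]_n)
    (mL : torus A Z -> 'M[R[i]]_(mc, md)) :
    crystal_fun A Z d -> crystal_fun A Z c :=
  fun f x => \sum_(y \in [set: torus A Z]) (mL y *m f (x + y)).
Arguments mult_op {R n A Z md mc} d c mL.

Definition coset_representatives (R : realType) (n : nat) (A C : 'M[R]_n)
    (p : nat) (t : 'I_p -> lattice A) : Prop :=
  bijective (fun k => tcoset A C (t k)).
Arguments coset_representatives {R n A} C {p} t.

(* The tuple (t_1 + s, ..., t_p + s), indexed block by block. *)
Definition hat (R : realType) (n : nat) (A : 'M[R]_n) (p m : nat)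
    (t : 'I_p -> lattice A) (s : 'I_m -> 'cV[R]_n) :
    'I_(\sum_(k < p) m) -> 'cV[R]_n :=
  fun j => lattice_val (t (tagnat.sig1 j)) + s (tagnat.sig2 j).
Arguments hat {R n A p m} t s.

Lemma structure_element_hat (R : realType) (n : nat) (A C : 'M[R]_n)
    (p m : nat) (t : 'I_p -> lattice A) (s : 'I_m -> 'cV[R]_n) :
  {subset lattice_set C <= lattice_set A} ->
  coset_representatives C t -> structure_element A s ->
  structure_element C (hat t s).
Proof.
move=> CA [k tK kK] [P Pcell Ps].
exists [set y | exists i, P (y - lattice_val (t i))]%classic; last first.
  by move=> j; exists (tagnat.sig1 j); rewrite addrAC subrr add0r.
move=> y; have [x [[xA Px] x_uniq]] := Pcell y.
pose i := k (tcoset A C (Lattice xA)).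
have /coset_eqP /= xi : tcoset A C (Lattice xA) = tcoset A C (t i).
  by rewrite [RHS]kK.
exists (x - lattice_val (t i)); split.
  by split=> //; exists i; rewrite opprB addrA addrAC addrK.
move=> z [zC [j Pj]]; have xz : x = z + lattice_val (t j).
  apply: x_uniq; split; last by rewrite opprD addrA.
  by apply: rpredD; [exact: CA|exact: latticeP].
suff -> : i = j by rewrite xz addrK.
rewrite /i -[RHS]tK; congr (k _); apply/coset_eqP => /=.
by rewrite xz addrK.
Qed.

Section Refinement.
Context (R : realType) (n : nat) (A C Z : 'M[R]_n).
Hypothesis CA : {subset lattice_set C <= lattice_set A}.
Context (p : nat) (t : 'I_p -> lattice A).

Definition eta_map (m : nat) (s : 'I_m -> 'cV[R]_n) :
    crystal_fun A Z s -> crystal_fun C Z (hat t s) :=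
  fun f x => \mxcol_(k < p) f (torus_incl CA x + tcoset A Z (t k)).

Definition block_multiplier (md mc : nat)
    (mL : torus A Z -> 'M[R[i]]_(mc, md)) :
    torus C Z -> 'M[R[i]]_(\sum_(i < p) mc, \sum_(k < p) md) :=
  fun y => \mxblock_(i < p, k < p)
    mL (torus_incl CA y - tcoset A Z (t i) + tcoset A Z (t k)).

End Refinement.
Arguments eta_map {R n A C Z} CA {p} t {m} s.
Arguments block_multiplier {R n A C Z} CA {p} t {md mc} mL.

(* Main.v *)
(** Every point of L(A)/L(Z) is [y + t_k] for exactly one [y] in L(C)/L(Z) and
one [k].  This makes eta bijective, and substituting [y - t_i + t_k] for the
summation variable of [L f] at [x + t_i] produces the i-th block of
[G (eta f)] at [x]. *)
Require Import Defs.
From HB Require Import structures.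
From mathcomp Require Import all_boot all_order all_algebra.
From mathcomp Require Import all_classical all_reals.
From mathcomp Require Import complex.

Set Implicit Arguments.
Unset Strict Implicit.
Unset Printing Implicit Defensive.

Import Order.TTheory GRing.Theory Num.Theory.
Local Open Scope ring_scope.

Lemma tcosetD (R : realType) (n : nat) (A Z : 'M[R]_n) :
  {morph tcoset A Z : x y / x + y}.
Proof. by move=> x y; rewrite /tcoset raddfD. Qed.

Section Refinement.
Context (R : realType) (n : nat) (A C Z : 'M[R]_n).
Hypothesis ZC : {subset lattice_set Z <= lattice_set C}.
Hypothesis CA : {subset lattice_set C <= lattice_set A}.
Context (p : nat) (t : 'I_p -> lattice A).
Hypothesis t_repr : coset_representatives C t.

(** The [t k] separate the classes modulo [L(C)], and since [L(Z)] lies in [L(C)], an equality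
    modulo [L(Z)] already determines the class modulo [L(C)]. This fixes [k], and then [y] by
    cancellation. *)
Lemma torus_split_bij :
  bijective (fun yk : torus C Z * 'I_p =>
    torus_incl CA yk.1 + tcoset A Z (t yk.2)).
Proof.
have t_inj := bij_inj t_repr; case: t_repr => r _ rK.
rewrite -setTT_bijective; split=> //.
- move=> [x k] [y l] _ _ /=.
  have [[u ->] [v ->]] := (coset_surj x, coset_surj y).
  rewrite !torus_incl_coset -!tcosetD => uv.
  have kl : k = l.
    apply: t_inj; apply/coset_eqP.
    (* The difference of the two sums lies in [L(Z)], hence in [L(C)]; removing [u - v], also in
       [L(C)], leaves [t k - t l]. *)
    move/coset_eqP: uv => /= /ZC uv.
    have -> : lattice_val (t k) - lattice_val (t l) =
        (lattice_val u + lattice_val (t k) -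
         (lattice_val v + lattice_val (t l))) -
        (lattice_val u - lattice_val v).
      by rewrite opprD addrACA [RHS]addrC addKr.
    by apply: (rpredB uv); apply: rpredB; exact: latticeP.
  rewrite kl in uv *; congr pair; apply: (@torus_incl_inj _ _ _ _ _ CA).
  by move: uv; rewrite !tcosetD => /addIr; rewrite !torus_incl_coset.
- move=> X _; have [a ->] := coset_surj X.
  (* The representative chosen by [r] is congruent to [a] modulo [L(C)], so their difference
     supplies the component in [L(C)]. *)
  have /coset_eqP uC := esym (rK (tcoset A C a)).
  exists (tcoset C Z (Lattice uC), r (tcoset A C a)) => //=.
  rewrite torus_incl_coset -tcosetD; congr (tcoset A Z _).
  by apply: val_inj; rewrite /= subrK.
Qed.

Lemma eta_map_linear (m : nat) (s : 'I_m -> 'cV[R]_n) :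
  linear (eta_map (Z := Z) CA t s).
Proof.
move=> a f g; apply/funext => x; apply/mxcolP => k.
by apply/matrixP => i j; rewrite !mxE.
Qed.

(** The inverse splits [X] as [y + t k] through [h] and reads block [k] of [g y]. *)
Lemma eta_map_bij (m : nat) (s : 'I_m -> 'cV[R]_n) :
  bijective (eta_map (Z := Z) CA t s).
Proof.
have [h hK Kh] := torus_split_bij.
exists (fun g X => @submxcol _ p (fun=> m) 1 (g (h X).1) (h X).2) => [f|g].
  by apply/funext => X; rewrite mxcolK (Kh X).
apply/funext => x; rewrite -[RHS]submxcolK; apply: eq_mxcol => k.
by rewrite (hK (x, k)).
Qed.

Lemma eta_map_mult_op (md mc : nat) (d : 'I_md -> 'cV[R]_n)
    (c : 'I_mc -> 'cV[R]_n) (mL : torus A Z -> 'M[R[i]]_(mc, md))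
    (f : crystal_fun A Z d) :
  Z \in unitmx ->
  eta_map CA t c (mult_op d c mL f) =
  mult_op (hat t d) (hat t c) (block_multiplier CA t mL) (eta_map CA t d f).
Proof.
move=> Zu; apply/funext => x; rewrite /mult_op.
(* Invertibility of [Z] makes [L(C)/L(Z)] finite, so the sum defining [G] becomes an ordinary finite
   sum. *)
have finC := torus_finite Zu ZC.
rewrite fsbig_finite//=; under [RHS]eq_bigr do rewrite mul_mxblock_mxrow.
apply/mxcolP => i; rewrite mxcolK.
(* Extracting block [i] is additive, hence commutes with the sum over [y]. *)
rewrite [RHS](big_morph ((@submxcol _ p (fun=> mc) 1)^~ i)
  (fun B B' => submxcolD B B' i) (submxcol0 _ i)).
(* The substitution is the splitting bijection followed by translation by [- t i]. *)
have shift_bij : bijective (fun yk : torus C Z * 'I_p =>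
    torus_incl CA yk.1 - tcoset A Z (t i) + tcoset A Z (t yk.2)).
  have sub_bij : bijective (fun X => X - tcoset A Z (t i)).
    by exists (+%R^~ (tcoset A Z (t i))) => X; rewrite ?addrK ?subrK.
  apply: (eq_bij (bij_comp sub_bij torus_split_bij)) => -[y k] /=.
  exact: addrAC.
rewrite (reindex_fsbigT _ _ shift_bij) -setXTT.
pose F y k : 'cV_mc :=
  let z := torus_incl CA y - tcoset A Z (t i) + tcoset A Z (t k) in
  mL z *m f (torus_incl CA x + tcoset A Z (t i) + z).
rewrite -(pair_fsbig _ F finC finite_finset) fsbig_finite//=; apply: eq_bigr => y _; rewrite mxcolK.
have -> : [set: 'I_p]%classic = [set` index_enum 'I_p]%classic.
  by apply/esym/seteqP; split=> k //= _; rewrite mem_index_enum.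
rewrite -fsbig_seq ?index_enum_uniq//; apply: eq_bigr => k _.
(* The shift [- t i] in the multiplier's index cancels the [t i] at which [L f] is evaluated,
   leaving [x + y + t k]. *)
by congr (_ *m f _); rewrite torus_inclD addrA [in LHS]addrACA subrr addr0.
Qed.

End Refinement.

Theorem theorem5p3 (R : realType) (n : nat) (A C Z : 'M[R]_n)
    (A_basis : A \in unitmx) (C_basis : C \in unitmx) (Z_basis : Z \in unitmx)
    (ZC : {subset lattice_set Z <= lattice_set C})
    (CA : {subset lattice_set C <= lattice_set A})
    (md mc : nat) (d : 'I_md -> 'cV[R]_n) (c : 'I_mc -> 'cV[R]_n)
    (d_struct : structure_element A d) (c_struct : structure_element A c)
    (mL : torus A Z -> 'M[R[i]]_(mc, md))
    (p : nat) (t : 'I_p -> lattice A)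
    (t_repr : coset_representatives C t) :
  let L := mult_op d c mL in
  let G := mult_op (hat t d) (hat t c) (block_multiplier CA t mL) in
  [/\ linear (eta_map (Z := Z) CA t d) /\ bijective (eta_map (Z := Z) CA t d),
      linear (eta_map (Z := Z) CA t c) /\ bijective (eta_map (Z := Z) CA t c) &
      eta_map CA t c \o L = G \o eta_map CA t d].
Proof.
move=> L G; split; try by split; [exact: eta_map_linear | exact: eta_map_bij].
by apply/funext => f; exact: eta_map_mult_op.
Qed.
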